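(* Let $X$ be a set which is either finite with $|X|\ge 3$ or countably infinite. Then the Cox configuration $\mathrm{Cox}(X)$ can be realized on a $2$-sphere $\mathcal{S}$ in a Euclidean $3$-space, with the blocks interpreted as circles on $\mathcal{S}$; that is, there exist an injective map $f$ from the set of points of $\mathrm{Cox}(X)$ to $\mathcal{S}$ and an injective map $g$ from the set of blocks of $\mathrm{Cox}(X)$ to the set of circles lying on $\mathcal{S}$ such that $f(p)\in g(b)$ whenever the point $p$ is incident with the block $b$.
   Context: Let $X$ be a set with $|X|\ge 3$. The Cox configuration $\mathrm{Cox}(X)$ is the incidence structure whose points are the finite subsets of $X$ of even cardinality (including $\emptyset$) and whose blocks are the finite subsets of $X$ of odd cardinality, where a point $p$ and a block $b$ are incident iff either $p\subset b$ and $|b\setminus p|=1$, or $b\subset p$ and $|p\setminus b|=1$ (i.e. one is a direct successor of the other with respect to inclusion). *)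

(* Defs.v *)
From HB Require Import structures.
From mathcomp Require Import all_boot all_order all_algebra finmap.
From mathcomp Require Import all_classical all_reals.

Set Implicit Arguments.
Unset Strict Implicit.
Unset Printing Implicit Defensive.

Import Order.TTheory GRing.Theory Num.Theory.
Local Open Scope classical_set_scope.
Local Open Scope ring_scope.

Record incidence_structure := IncidenceStructure {
  point : Type;
  block : Type;
  incident : point -> block -> Prop }.

Definition cox_point (X : choiceType) := {p : {fset X} | ~~ odd #|` p|%fset}.
Definition cox_block (X : choiceType) := {b : {fset X} | odd #|` b|%fset}.

Definition direct_succ (X : choiceType) (A B : {fset X}) : bool :=
  (A `<=` B)%fset && (#|` (B `\` A)%fset|%fset == 1%N).

Definition Cox (X : choiceType) : incidence_structure :=
  @IncidenceStructure (cox_point X) (cox_block X)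
    (fun p b => direct_succ (val p) (val b) || direct_succ (val b) (val p)).

(* The norm that the library puts on 'rV[R]_3 is the sup norm, hence this
   explicit Euclidean inner product. *)
Definition dot (R : realType) (u v : 'rV[R]_3) : R := \sum_i u 0 i * v 0 i.

Definition edist (R : realType) (x y : 'rV[R]_3) : R :=
  Num.sqrt (dot (x - y) (x - y)).

Definition sphere (R : realType) (c : 'rV[R]_3) (r : R) : set 'rV[R]_3 :=
  [set x | edist x c = r].

Definition is_sphere (R : realType) (S : set 'rV[R]_3) : Prop :=
  exists (c : 'rV[R]_3) (r : R), 0 < r /\ S = sphere c r.

(* A circle of positive radius r about c, in the plane through c orthogonal
   to the nonzero vector n. *)
Definition is_circle (R : realType) (C : set 'rV[R]_3) : Prop :=
  exists (c n : 'rV[R]_3) (r : R),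
    [/\ n != 0, 0 < r & C = [set x | edist x c = r /\ dot (x - c) n = 0]].

Definition realizable_on (R : realType) (S : set 'rV[R]_3)
    (I : incidence_structure) : Prop :=
  exists (f : point I -> 'rV[R]_3) (g : block I -> set 'rV[R]_3),
    [/\ injective f /\ (forall p, S (f p)),
        injective g /\ (forall b, is_circle (g b) /\ g b `<=` S)
      & forall p b, incident p b -> g b (f p)].

(* Main.v *)
(** Send each element of [X] to a unit vector [v_x] of the plane, a point [p]
    to the sum of the [v_x] over [x] in [p], and a block [b] to the unit circle
    centred at the sum of the [v_x] over [x] in [b].  Incident [p] and [b] differ
    by one element, so the point lies on the circle.  If the first coordinates
    of the [v_x] are distinct negative powers of 2, all subset sums are distinct.
    Inverse stereographic projection carries the picture to the sphere. *)
Require Import Defs.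
From HB Require Import structures.
From mathcomp Require Import all_boot all_order all_algebra finmap.
From mathcomp Require Import all_classical all_reals.
From mathcomp Require Import ring lra.

Set Implicit Arguments.
Unset Strict Implicit.
Unset Printing Implicit Defensive.

Import Order.TTheory GRing.Theory Num.Theory.
Local Open Scope classical_set_scope.
Local Open Scope card_scope.
Local Open Scope ring_scope.

(** Splitting off the leading digit leaves half of a shorter sum of the same shape. The upper bound
    is strict because there are finitely many digits, which rules out the ambiguity 0.0111... =
    0.1. *)
Lemma binary_sum_bounds (R : realFieldType) M (a : nat -> bool) :
  (0 : R) <= \sum_(i < M) (a i)%:R * 2^-1 ^+ i.+1 < (1 : R).
Proof.
elim: M a => [|M IHM] a; first by rewrite big_ord0 lexx ltr01.
rewrite big_ord_recl /=.
have -> : \sum_(i < M) (a (lift ord0 i))%:R * 2^-1 ^+ (lift ord0 i).+1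
    = 2^-1 * \sum_(i < M) (a i.+1)%:R * 2^-1 ^+ i.+1 :> R.
  by rewrite mulr_sumr; apply: eq_bigr => i _; rewrite (exprS _ i.+1) mulrCA.
by move: (IHM (fun i => a i.+1)); case: (a 0%N) => /andP[] /=;
  rewrite expr1; lra.
Qed.

(** Both tails lie in [0, 1), so they cannot make up for a difference of 1 between leading digits;
    cancel these and recurse. *)
Lemma binary_sum_inj (R : realFieldType) M (a b : nat -> bool) :
  \sum_(i < M) (a i)%:R * 2^-1 ^+ i.+1
    = \sum_(i < M) (b i)%:R * 2^-1 ^+ i.+1 :> R ->
  forall i, (i < M)%N -> a i = b i.
Proof.
have shift M' (c : nat -> bool) :
    \sum_(i < M'.+1) (c i)%:R * 2^-1 ^+ i.+1
    = 2^-1 * ((c 0%N)%:R + \sum_(i < M') (c i.+1)%:R * 2^-1 ^+ i.+1) :> R.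
  rewrite big_ord_recl /= mulrDr expr1 mulrC mulr_sumr; congr (_ + _).
  by apply: eq_bigr => i _; rewrite (exprS _ i.+1) mulrCA.
elim: M a b => [|M IHM] a b //; rewrite !shift => E.
have /andP[a0 a1] := binary_sum_bounds R M (fun i => a i.+1).
have /andP[b0 b1] := binary_sum_bounds R M (fun i => b i.+1).
have ab0 : a 0%N = b 0%N.
  by move: E a0 a1 b0 b1; case: (a 0%N); case: (b 0%N) => //=; lra.
case=> [|i] // ltiM; apply: (IHM (fun i => a i.+1) (fun i => b i.+1)) => //.
move: E; rewrite ab0 => /mulfI E.
by apply: (addrI (b 0%N)%:R); apply: E; rewrite invr_eq0 pnatr_eq0.
Qed.

(** Rewrites a sum over a finite set as a digit expansion, so that two sets can be compared digit by
    digit. *)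
Lemma big_fset_indicator (R : pzRingType) (X : choiceType) (h : X -> nat)
    (F : nat -> R) (A : {fset X}) M :
  injective h -> (forall x, x \in A -> h x < M)%N ->
  \sum_(x <- A) F (h x) = \sum_(i < M) ((i : nat) \in map h A)%:R * F i.
Proof.
move=> h_inj hM; rewrite -(big_map h xpredT F).
rewrite -(big_mkord xpredT (fun i => (i \in map h A)%:R * F i)).
rewrite /index_iota subn0.
under [RHS]eq_bigr => i _ do rewrite mulr_natl mulrb.
rewrite -big_mkcond -[RHS]big_filter; apply: perm_big; apply: uniq_perm.
- by rewrite map_inj_uniq.
- by rewrite filter_uniq // iota_uniq.
move=> i; rewrite mem_filter mem_iota /=.
by case: mapP => //= -[x xA ->]; rewrite hM.
Qed.

Lemma fset_binary_sum_inj (R : realFieldType) (X : choiceType) (h : X -> nat) :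
  injective h ->
  injective (fun A : {fset X} => \sum_(x <- A) 2^-1 ^+ (h x).+1 : R).
Proof.
move=> h_inj A B /=.
(* One length for both expansions; the successor makes the bound on [h] strict. *)
set M := (\max_(x <- (A `|` B)%fset) (h x)).+1.
have hM x : x \in (A `|` B)%fset -> (h x < M)%N.
  by move=> xAB; rewrite ltnS; exact: leq_bigmax_seq.
rewrite !(@big_fset_indicator _ _ h (fun i => 2^-1 ^+ i.+1) _ M) //;
  try by move=> x xA; apply: hM; rewrite in_fsetU xA ?orbT.
move/(@binary_sum_inj R M (fun i => i \in map h A) (fun i => i \in map h B)).
move=> E; apply/fsetP => x.
have [xAB|] := boolP (x \in (A `|` B)%fset).
  by have /= := E _ (hM _ xAB); rewrite !mem_map.
by rewrite in_fsetU negb_or => /andP[/negPf-> /negPf->].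
Qed.

(** The added element [x] is chosen before [F], so the same [x] serves both coordinate sums. *)
Lemma direct_succ_big (V : nmodType) (X : choiceType) (A B : {fset X}) :
  direct_succ A B ->
  exists x, forall F : X -> V, \sum_(y <- B) F y = F x + \sum_(y <- A) F y.
Proof.
case/andP => /fsubsetP AB /cardfs1P[x BAx]; exists x => F.
have xBA : x \in (B `\` A)%fset by rewrite BAx in_fset1.
have -> : B = (x |` A)%fset.
  apply/fsetP => y; rewrite in_fset1U -in_fset1 -BAx in_fsetD.
  by case: (boolP (y \in A)) => [/AB->|_]; rewrite ?orbF.
by rewrite big_fsetU1 //; move: xBA; rewrite in_fsetD => /andP[].
Qed.

Lemma dotE (R : realType) (u v : 'rV[R]_3) :
  dot u v = u 0 0 * v 0 0 + u 0 1 * v 0 1 + u 0 2 * v 0 2.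
Proof.
rewrite /dot !big_ord_recl big_ord0 addr0 addrA.
by congr (_ + _ * _ + _ * _); congr (_ _ _); apply/val_inj.
Qed.

Lemma dot_ge0 (R : realType) (u : 'rV[R]_3) : 0 <= dot u u.
Proof. by apply: sumr_ge0 => i _; rewrite -expr2 sqr_ge0. Qed.

Lemma edist_eq (R : realType) (x y : 'rV[R]_3) (r : R) : 0 <= r ->
  edist x y = r <-> dot (x - y) (x - y) = r ^+ 2.
Proof.
move=> r0; rewrite /edist; split=> [<-|->]; first by rewrite sqr_sqrtr ?dot_ge0.
by rewrite sqrtr_sqr ger0_norm.
Qed.

Definition plane_section (R : realType) (n : 'rV[R]_3) (d : R) :
  set 'rV[R]_3 := [set x | dot x x = 1 /\ dot x n = d].

(** The centre is the foot of the perpendicular from the origin to the plane; Pythagoras gives the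
    squared radius [1 - d ^+ 2 / dot n n]. *)
Lemma plane_section_circle (R : realType) (n : 'rV[R]_3) (d : R) :
  d ^+ 2 < dot n n -> is_circle (plane_section n d).
Proof.
move=> dn; have n_gt0 : 0 < dot n n by apply: le_lt_trans dn; apply: sqr_ge0.
have n_neq0 : dot n n != 0 by rewrite gt_eqF.
have r_gt0 : 0 < 1 - d ^+ 2 / dot n n by rewrite subr_gt0 ltr_pdivrMr ?mul1r.
exists ((d / dot n n) *: n), n, (Num.sqrt (1 - d ^+ 2 / dot n n)); split.
- by apply: contraNneq n_neq0 => ->; rewrite dotE !mxE !mul0r !addr0.
- by rewrite sqrtr_gt0.
have sub_dot (x : 'rV[R]_3) k : dot (x - k *: n) n = dot x n - k * dot n n.
  by rewrite !dotE !mxE; ring.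
have sub_dot2 (x : 'rV[R]_3) k : dot (x - k *: n) (x - k *: n) =
    dot x x - 2 * k * dot x n + k ^+ 2 * dot n n.
  by rewrite !dotE !mxE; ring.
apply/seteqP; split=> x /=; rewrite edist_eq ?sqrtr_ge0 // sqr_sqrtr ?ltW //;
  rewrite sub_dot sub_dot2 divfK // => -[].
- by move=> -> ->; split; [field | ring].
- move=> E /eqP; rewrite subr_eq0 => /eqP xn; split=> //; move: E; rewrite xn.
  move=> E; apply: (@addIr _ (- (d ^+ 2 / dot n n))); rewrite -E.
  by field.
Qed.

Definition vec3 (R : realType) (a b c : R) : 'rV[R]_3 :=
  \row_(j < 3) [:: a; b; c]`_j.

Lemma dot_vec3 (R : realType) (a b c a' b' c' : R) :
  dot (vec3 a b c) (vec3 a' b' c') = a * a' + b * b' + c * c'.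
Proof. by rewrite dotE !mxE. Qed.

(** The projection is from the pole [(0, 0, 1)] onto the equatorial plane. *)
Definition inv_stereo (R : realType) (x y : R) : 'rV[R]_3 :=
  let q := x ^+ 2 + y ^+ 2 in
  vec3 (2 * x / (q + 1)) (2 * y / (q + 1)) ((q - 1) / (q + 1)).

Lemma stereo_den_neq0 (R : realType) (x y : R) : x ^+ 2 + y ^+ 2 + 1 != 0.
Proof. by rewrite gt_eqF // ltr_wpDl // addr_ge0 ?sqr_ge0. Qed.

Lemma inv_stereo_unit (R : realType) (x y : R) :
  dot (inv_stereo x y) (inv_stereo x y) = 1.
Proof. by rewrite dot_vec3; field; apply: stereo_den_neq0. Qed.

Lemma inv_stereo_inj1 (R : realType) (x y x' y' : R) :
  inv_stereo x y = inv_stereo x' y' -> x = x'.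
Proof.
(* This quotient is the first coordinate of the stereographic projection. *)
move=> E; have := congr1 (fun v : 'rV[R]_3 => v 0 0 / (1 - v 0 2)) E.
have red (a b : R) : (inv_stereo a b) 0 0 / (1 - (inv_stereo a b) 0 2) = a.
  rewrite !mxE /=; field; rewrite stereo_den_neq0.
  by rewrite (_ : _ + 1 - _ = 2) ?pnatr_eq0 //; ring.
by rewrite !red.
Qed.

(* The plane meeting the sphere in the stereographic image of the unit circle
   centred at [(a, b)]. *)
Definition stereo_circle (R : realType) (a b : R) : set 'rV[R]_3 :=
  plane_section (vec3 (2 * a) (2 * b) (a ^+ 2 + b ^+ 2 - 2)) (a ^+ 2 + b ^+ 2).

Lemma is_circle_stereo_circle (R : realType) (a b : R) :
  is_circle (stereo_circle a b).
Proof.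
apply: plane_section_circle; rewrite dot_vec3 -subr_gt0.
(* With [q = a ^+ 2 + b ^+ 2] the difference is [4 * q + (q - 2) ^+ 2 - q ^+ 2]. *)
by rewrite (_ : _ - _ = 4) ?ltr0n //; ring.
Qed.

Lemma stereo_circleP (R : realType) (a b x y : R) :
  stereo_circle a b (inv_stereo x y) <-> (x - a) ^+ 2 + (y - b) ^+ 2 = 1.
Proof.
have den := stereo_den_neq0 x y.
(* The equation of the plane pulls back to that of the unit circle, up to a nonzero factor. *)
have key : dot (inv_stereo x y) (vec3 (2 * a) (2 * b) (a ^+ 2 + b ^+ 2 - 2))
    - (a ^+ 2 + b ^+ 2)
    = - 2 / (x ^+ 2 + y ^+ 2 + 1) * ((x - a) ^+ 2 + (y - b) ^+ 2 - 1).
  by rewrite dot_vec3; field.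
rewrite /stereo_circle /plane_section /= inv_stereo_unit; split.
- move=> [_ /eqP]; rewrite -subr_eq0 key mulf_eq0 mulf_eq0 invr_eq0.
  by rewrite (negPf den) oppr_eq0 pnatr_eq0 /= subr_eq0 => /eqP.
- by move=> E; split=> //; apply/eqP; rewrite -subr_eq0 key E subrr mulr0.
Qed.

Lemma stereo_circle_inj1 (R : realType) (a b a' b' : R) :
  stereo_circle a b = stereo_circle a' b' -> a = a'.
Proof.
move=> E.
have on x : (x - a) ^+ 2 = 1 -> (x - a') ^+ 2 + (b - b') ^+ 2 = 1.
  move=> xa; apply/stereo_circleP; rewrite -E; apply/stereo_circleP.
  by rewrite xa subrr expr0n addr0.
(* Subtracting the equations at the two ends of the horizontal diameter gives [4 * (a - a') = 0]. *)
have := on (a + 1); have := on (a - 1).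
by move=> /(_ ltac:(ring)) E1 /(_ ltac:(ring)) E2; nra.
Qed.

Theorem theorem3p7 (R : realType) (X : choiceType)
  (hX : (exists n : nat, (3 <= n)%N /\ [set: X] #= `I_n) \/
        [set: X] #= [set: nat]) :
  exists S : set 'rV[R]_3, is_sphere S /\ realizable_on S (Cox X).
Proof.
have /countable_injP[h XtoN_inj] : countable [set: X].
  case: hX => [[n [_ Xn]]|XN]; last by rewrite (eq_countable XN).
  by apply: finite_set_countable; exists n.
have h_inj : injective h by move=> x y; apply: XtoN_inj; rewrite in_setT.
pose u x : R := 2^-1 ^+ (h x).+1.
(* Completes [u x] to a unit vector; as [0 <= u x <= 1], the root is not the default value 0 taken
   at negative numbers. *)
pose w x : R := Num.sqrt (1 - u x ^+ 2).
have uw x : u x ^+ 2 + w x ^+ 2 = 1.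
  rewrite sqr_sqrtr; first by rewrite addrC subrK.
  by rewrite subr_ge0 /u -exprM exprn_ile1 ?invr_ge0 ?ler0n // invf_le1 ?ler1n.
pose U (A : {fset X}) := \sum_(x <- A) u x.
pose W (A : {fset X}) := \sum_(x <- A) w x.
have U_inj : injective U by apply: fset_binary_sum_inj.
exists (sphere 0 1); split; first by exists 0, 1.
have sphereP x : sphere 0 1 x <-> dot x x = 1 :> R.
  by rewrite /sphere /= edist_eq // subr0 expr1n.
exists (fun p : cox_point X => inv_stereo (U (val p)) (W (val p))).
exists (fun b : cox_block X => stereo_circle (U (val b)) (W (val b))).
split; [split|split|].
- by move=> p q /inv_stereo_inj1/U_inj/val_inj.
- by move=> p; apply/sphereP/inv_stereo_unit.
- by move=> b c /stereo_circle_inj1/U_inj/val_inj.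
- move=> b; split; first exact: is_circle_stereo_circle.
  by move=> x [x1 _]; apply/sphereP.
(* Whichever of the two sets is larger, the planar point minus the centre is [(u x, w x)] up to
   sign. *)
move=> p b /orP[] /(@direct_succ_big R)[x xE]; apply/stereo_circleP;
  rewrite /U /W !xE -[RHS](uw x); ring.
Qed.
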